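(* Let $k$ be any field of characteristic $2$, and define the polynomial endomorphism $F=(P,Q,R)\colon \mathbb{A}_k^3\to\mathbb{A}_k^3$ by $$F(x,y,z)=\bigl(x+x^2y,\; y+xz+x^2yz,\; z+x^2z^2\bigr).$$ Then $$\det \operatorname{Jac}(F)=1,\qquad [k(x,y,z):k(P,Q,R)]=3,$$ and $F$ is not injective. Consequently, the separable Jacobian conjecture is false in characteristic $2$ and dimension $3$.
   Context: Here $P=x+x^2y$, $Q=y+xz+x^2yz$, $R=z+x^2z^2$ in $k[x,y,z]$; $\operatorname{Jac}(F)$ is the $3\times 3$ matrix of formal partial derivatives of $(P,Q,R)$ with respect to $(x,y,z)$, and $k(P,Q,R)$ is the subfield of the rational function field $k(x,y,z)$ generated over $k$ by $P,Q,R$. ''Not injective'' means that two distinct points of $k^3$ have the same image under $F$. The separable Jacobian conjecture (in characteristic $p>0$ and dimension $n$) is the following assertion. Let $k$ be a field of characteristic $p>0$, let $X=(x_1,\dots,x_n)$, and let $F=(F_1,\dots,F_n)\in k[X]^n$. Write $k(F)=k(F_1,\dots,F_n)\subseteq k(X)=k(x_1,\dots,x_n)$. Assume that $\det\operatorname{Jac}(F)\in k^\times$ and $p\nmid [k(X):k(F)]$. Then $F$ is a polynomial automorphism of $\mathbb{A}_k^n$ (i.e. it has a two-sided inverse given by polynomials over $k$). *)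

(* Defs.v *)
From HB Require Import structures.
From mathcomp Require Import all_boot all_order all_algebra.
From mathcomp Require Import mpoly.

Set Implicit Arguments.
Unset Strict Implicit.
Unset Printing Implicit Defensive.

Import GRing.Theory.
Local Open Scope ring_scope.

Section Subfields.
Variable L : fieldType.

(* Since a / 0 = 0 in a fieldType, the last clause needs no b != 0. *)
Inductive subfield_gen (A : L -> Prop) : L -> Prop :=
| subfield_gen_incl a : A a -> subfield_gen A a
| subfield_gen_1 : subfield_gen A 1
| subfield_gen_sub a b :
    subfield_gen A a -> subfield_gen A b -> subfield_gen A (a - b)
| subfield_gen_div a b :
    subfield_gen A a -> subfield_gen A b -> subfield_gen A (a / b).

(* [L : K] = d: L has a d-element basis as a K-vector space.  The degree is a
   relation because K is an arbitrary (Prop-valued) subset of L and L may be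
   infinite dimensional over K. *)
Definition has_degree (K : L -> Prop) (d : nat) : Prop :=
  exists b : 'I_d -> L,
    (forall a : L, exists c : 'I_d -> L,
        (forall i, K (c i)) /\ a = \sum_(i < d) c i * b i) /\
    (forall c : 'I_d -> L, (forall i, K (c i)) ->
        \sum_(i < d) c i * b i = 0 -> forall i, c i = 0).

End Subfields.

Section PolynomialMaps.
Variables (k : fieldType) (n : nat).
Implicit Type F : n.-tuple {mpoly k[n]}.

Definition polymap F (v : n.-tuple k) : n.-tuple k :=
  [tuple (tnth F i).@[tnth v] | i < n].

Definition jacobian F : 'M[{mpoly k[n]}]_n :=
  \matrix_(i < n, j < n) (tnth F i)^`M(j).

Definition ratfun : fieldType := {fraction {mpoly k[n]}}.

Definition ratfun_gen F : ratfun -> Prop :=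
  subfield_gen (fun a : ratfun =>
    (exists c : k, a = tofrac c%:MP) \/ (exists i : 'I_n, a = tofrac (tnth F i))).

Definition polynomial_automorphism F : Prop :=
  exists G : n.-tuple {mpoly k[n]},
    (forall i, tnth F i \mPo G = 'X_i) /\ (forall i, tnth G i \mPo F = 'X_i).

End PolynomialMaps.

Definition separable_jacobian_conjecture (p n : nat) : Prop :=
  forall k : fieldType, p \in [pchar k] ->
  forall F : n.-tuple {mpoly k[n]},
    (exists2 c : k, c != 0 & \det (jacobian F) = c%:MP) ->
    (exists2 d : nat, has_degree (ratfun_gen F) d & ~~ (p %| d)%N) ->
    polynomial_automorphism F.

Definition F3 (k : fieldType) : 3.-tuple {mpoly k[3]} :=
  let x : {mpoly k[3]} := 'X_0 in
  let y : {mpoly k[3]} := 'X_1 in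
  let z : {mpoly k[3]} := 'X_2 in
  [tuple x + x ^+ 2 * y;
         y + x * z + x ^+ 2 * y * z;
         z + x ^+ 2 * z ^+ 2].

(* Main.v *)
Require Import Defs.
From HB Require Import structures.
From mathcomp Require Import all_boot all_order all_algebra.
From mathcomp Require Import mpoly ring.

Set Implicit Arguments.
Unset Strict Implicit.
Unset Printing Implicit Defensive.

Import GRing.Theory.
Local Open Scope ring_scope.

(** Write K = k(P, Q, R) and L = k(x, y, z).

    Degree at most 3.  Since Q = y + z P, the variable y is eliminated from
    P = x + x^2 y, which makes z, and then y, a rational function of x, P and
    Q; hence L = K(x).  Substituting into R = z + x^2 z^2 and using 2 = 0 gives
<<
      Q^2 x^3 + (P Q + 1 + R P^2) x + P = 0          (cubic_relation).
>>

    Degree at least 3.  No lower relation can hold, because the fibre of F over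
    the points with R = 0 splits into three rational sheets: the substitutions
<<
      (x, y, z) := (x, y, 0),  (x + 1/y, y, 0),  (1/y, y + y^2 (x + x^2 y), y^2)
>>
    into k(x, y) all send (P, Q, R) to (x + x^2 y, y, 0), and they give the
    first coordinate three distinct values (fiber_pointP, fiber_point_inj).
    A relation A0 + A1 x + A2 x^2 = 0 with the Ai polynomials in P, Q, R then
    becomes a polynomial of degree at most 2 with three roots, so all the
    Ai (x + x^2 y, y, 0) vanish.  As x + x^2 y and y are algebraically
    independent, R divides every Ai; dividing the relation by R and iterating
    forces Ai = 0 (specialization_independent).  This argument gives at the
    same time the algebraic independence of P, Q, R, so that K is the fraction
    field of a polynomial ring in three indeterminates.  Knowing the degree of
    x over K, inverses in K[x] come from the Bezout identity, and K[x] is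
    all of L.

    The Jacobian determinant is a direct computation, and at x = 0, y = 1 the
    first two sheets give the colliding points (0, 1, 0) and (1, 1, 0).  A
    polynomial automorphism is injective on points, so over the field with two
    elements F contradicts the conjecture. *)

(** * Fraction fields *)

Section Fractions.
Variable D : idomainType.

Lemma fraction_repr (a : {fraction D}) :
  a = tofrac \n_(repr a) / tofrac \d_(repr a).
Proof.
have d0 : tofrac \d_(repr a) != 0 by rewrite tofrac_eq0 denom_ratioP.
apply: (mulIf d0); rewrite divfK // -[X in X * _](reprK a).
unlock tofrac; rewrite -[LHS]FracField.pi_mul; apply/eqmodP => /=.
rewrite /FracField.equivf /FracField.mulf !numden_Ratio
  ?(mulr1, mul1r, mulf_neq0, oner_neq0, denom_ratioP) //.
by rewrite mulrC.
Qed.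

Lemma fraction_quotient (a : {fraction D}) :
  exists n d : D, d != 0 /\ a = tofrac n / tofrac d.
Proof.
exists \n_(repr a), \d_(repr a).
by split; [exact: denom_ratioP | exact: fraction_repr].
Qed.

Lemma fraction_lift (L : fieldType) (f : {rmorphism D -> L}) :
  injective f ->
  exists iota : {rmorphism {fraction D} -> L}, forall t, iota (tofrac t) = f t.
Proof.
move=> f_inj.
have f_neq0 d : d != 0 -> f d != 0 by rewrite -(rmorph0 f) (inj_eq f_inj).
pose g (a : {fraction D}) := f \n_(repr a) / f \d_(repr a).
have gE n d : d != 0 -> g (tofrac n / tofrac d) = f n / f d.
  move=> d0; apply/eqP; rewrite eqr_div ?f_neq0 ?denom_ratioP //.
  rewrite -!rmorphM (inj_eq f_inj) -tofrac_eq !tofracM.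
  by rewrite -eqr_div ?tofrac_eq0 ?denom_ratioP // -fraction_repr.
have gT t : g (tofrac t) = f t.
  by rewrite -[tofrac t]divr1 -(tofrac1 D) gE ?oner_neq0 // rmorph1 divr1.
have gB : zmod_morphism g.
  move=> a b; have [n [d [d0 ->]]] := fraction_quotient a.
  have [m [e [e0 ->]]] := fraction_quotient b.
  rewrite -mulNr addf_div ?tofrac_eq0 // -tofracN -!tofracM -tofracD.
  rewrite !gE ?mulf_neq0 // -mulNr addf_div ?f_neq0 //.
  by rewrite !(rmorphM, rmorphD, rmorphN).
have gM : monoid_morphism g.
  split=> [|a b]; first by rewrite -(tofrac1 D) gT rmorph1.
  have [n [d [d0 ->]]] := fraction_quotient a.
  have [m [e [e0 ->]]] := fraction_quotient b.
  by rewrite mulf_div -!tofracM !gE ?mulf_neq0 // mulf_div !rmorphM.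
pose iotaB := GRing.isZmodMorphism.Build _ _ g gB.
pose iotaM := GRing.isMonoidMorphism.Build _ _ g gM.
pose iota : {rmorphism {fraction D} -> L} := HB.pack g iotaB iotaM.
by exists iota.
Qed.

Lemma tofrac_inj : injective (@tofrac D).
Proof. by move=> x y /eqP; rewrite tofrac_eq => /eqP. Qed.

Lemma poly_common_denominator (p : {poly {fraction D}}) :
  exists2 d : D, d != 0 &
  exists2 q : {poly D}, size q = size p
    & tofrac d *: p = map_poly (@tofrac D) q.
Proof.
have [d d0 [q qE]] : exists2 d : D, d != 0 &
    exists q : {poly D}, tofrac d *: p = map_poly (@tofrac D) q.
  elim/poly_ind: p => [|p a [d d0 [q qE]]].
    by exists 1; rewrite ?oner_neq0 //; exists 0; rewrite scaler0 rmorph0.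
  have [n [e [e0 ->]]] := fraction_quotient a.
  exists (d * e); first by rewrite mulf_neq0.
  exists (e *: (q * 'X) + (d * n)%:P).
  rewrite rmorphD /= map_polyC map_polyZ [map_poly _ (_ * _)]rmorphM /=
    map_polyX -qE.
  rewrite scalerDr -scalerAl scalerA tofracM [tofrac e * _]mulrC; congr (_ + _).
  rewrite -mul_polyC -polyCM; congr _%:P.
  by rewrite -mulrA [tofrac e * _]mulrC divfK ?tofrac_eq0 // tofracM.
exists d => //; exists q => //.
rewrite -[RHS](size_scale _ (a := tofrac d)) ?tofrac_eq0 // qE.
by rewrite (size_map_inj_poly tofrac_inj) ?rmorph0.
Qed.

End Fractions.

(** * Linear independence by specialization *)

Section Specialization.
Variables (D : nzRingType) (S E : idomainType) (n : nat).
Variables (Phi : {rmorphism {poly D} -> S}) (psi : {rmorphism D -> E}).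
Variables (phi : 'I_n -> {rmorphism S -> E}) (b : S).

(** Every [phi i] kills [Phi 'X], all of them agree on the image of [Phi], and
    they separate [b].  Applied to a relation of degree less than [n] in [b],
    they give [n] roots of the polynomial formed by the constant terms of its
    coefficients, hence ['X] divides every coefficient.  Since [Phi 'X] is not
    a zero divisor, this factor can be cancelled, and the descent terminates
    because the sizes of the coefficients drop. *)
Lemma specialization_independent :
    (forall i A, phi i (Phi A) = psi A.[0]) -> injective psi ->
    injective (fun i => phi i b) -> Phi 'X != 0 ->
  forall A : {poly {poly D}},
    (size A <= n)%N -> (map_poly Phi A).[b] = 0 -> A = 0.
Proof.
move=> phiE psi_inj b_inj X0.
suff IH N (A : {poly {poly D}}) : (forall i, size (A`_i)%R <= N)%N ->
    (size A <= n)%N -> (map_poly Phi A).[b] = 0 -> A = 0.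
  move=> A; apply: (IH (\max_(i < size A) size (A`_i)%R)%N) => i.
  have [iA|Ai] := ltnP i (size A); last by rewrite nth_default // size_poly0.
  exact: (leq_bigmax (Ordinal iA)).
elim: N A => [|N IH] A sA An Ab.
  by apply/polyP=> i; rewrite coef0; apply/eqP; rewrite -size_poly_leq0.
pose B := map_poly (psi \o horner_eval 0) A.
have B0 : B = 0.
  apply/eqP/negPn/negP=> Bn0.
  have := max_poly_roots Bn0 (rs := [seq phi i b | i : 'I_n]).
  rewrite size_map size_enum_ord ltnNge (leq_trans (size_poly _ _) An).
  move=> roots_lt; apply/notF/roots_lt; last by rewrite map_inj_uniq ?enum_uniq.
  apply/allP=> _ /mapP[i _ ->]; rewrite /root.
  have -> : B = map_poly (phi i) (map_poly Phi A).
    apply/polyP=> j; rewrite !coef_map_id0 ?rmorph0 //= ?phiE //.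
    by rewrite /= horner_evalE horner0 rmorph0.
  by rewrite horner_map Ab rmorph0.
have A0 i : (A`_i).[0] = 0.
  apply: psi_inj; rewrite rmorph0 -[RHS](coef0 _ i) -B0 coef_map_id0 //=.
  by rewrite horner_evalE horner0 rmorph0.
pose A' := map_poly (drop_poly 1) A.
have AE : A = 'X *: A'.
  apply/polyP=> i; rewrite coefZ coef_map_id0 ?drop_poly0r //.
  rewrite -[LHS](poly_take_drop 1) expr1 commr_polyX.
  suff -> : take_poly 1 A`_i = 0 by rewrite add0r.
  apply/polyP=> -[|j]; rewrite coef_take_poly coef0 //=.
  by rewrite -horner_coef0.
suff A'0 : A' = 0 by rewrite AE A'0 scaler0.
apply: IH.
- move=> i; rewrite coef_map_id0 ?drop_poly0r // size_drop_poly.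
  by rewrite leq_subLR add1n.
- exact: leq_trans (size_poly _ _) An.
- move/eqP: Ab; rewrite AE map_polyZ hornerZ mulf_eq0 (negPf X0).
  by move/eqP.
Qed.

End Specialization.

(** * Simple algebraic extensions *)

Section SimpleExtension.
Variables (F L : fieldType) (iota : {rmorphism F -> L}) (x : L).

Definition adjoined (a : L) : Prop :=
  exists p : {poly F}, a = (map_poly iota p).[x].

Lemma adjoined_base c : adjoined (iota c).
Proof. by exists c%:P; rewrite map_polyC hornerC. Qed.

Lemma adjoined_gen : adjoined x.
Proof. by exists 'X; rewrite map_polyX hornerX. Qed.

Lemma adjoinedD a b : adjoined a -> adjoined b -> adjoined (a + b).
Proof. by move=> [p ->] [q ->]; exists (p + q); rewrite rmorphD hornerD. Qed.

Lemma adjoinedM a b : adjoined a -> adjoined b -> adjoined (a * b).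
Proof. by move=> [p ->] [q ->]; exists (p * q); rewrite rmorphM hornerM. Qed.

Lemma adjoinedN a : adjoined a -> adjoined (- a).
Proof. by move=> [p ->]; exists (- p); rewrite rmorphN hornerN. Qed.

Lemma adjoinedX a n : adjoined a -> adjoined (a ^+ n).
Proof. by move=> [p ->]; exists (p ^+ n); rewrite rmorphXn horner_exp. Qed.

Lemma adjoined_mpoly (S : comNzRingType) n
    (u : {rmorphism {mpoly S[n]} -> L}) :
    (forall c, adjoined (u c%:MP)) -> (forall i, adjoined (u 'X_i)) ->
  forall p, adjoined (u p).
Proof.
move=> uC uX; elim/mpolyind=> [|c mon p _ _ IH].
  by exists 0; rewrite !rmorph0 horner0.
rewrite rmorphD -mul_mpolyC rmorphM.
apply: adjoinedD => //; apply: adjoinedM => //.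
rewrite mpolyXE_id rmorph_prod /=; elim/big_rec: _ => [|i b _ IHb].
  by exists 1; rewrite rmorph1 hornerC.
by apply: adjoinedM => //; rewrite rmorphXn; apply: adjoinedX.
Qed.

Variable m : {poly F}.
Hypotheses (m_neq0 : m != 0) (m_root : root (map_poly iota m) x).
Hypothesis m_min : forall p : {poly F},
  (size p < size m)%N -> (map_poly iota p).[x] = 0 -> p = 0.

(** Minimality of [m] replaces irreducibility: a common factor of [m] and [p]
    does not vanish at [x], since [p] does not, so its cofactor in [m] does,
    and minimality makes that factor constant. *)
Lemma adjoinedV a : adjoined a -> adjoined a^-1.
Proof.
case=> p aE; have [->|a0] := eqVneq a 0.
  by exists 0; rewrite invr0 rmorph0 horner0.
have cop : coprimep p m.
  have g0 : gcdp p m != 0 by rewrite gcdp_eq0 negb_and m_neq0 orbT.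
  rewrite coprimep_def.
  have gm := divpK (dvdp_gcdr p m); set h := m %/ _ in gm.
  have gx : (map_poly iota (gcdp p m)).[x] != 0.
    apply: contraNneq a0 => gx; rewrite aE -(divpK (dvdp_gcdl p m)).
    by rewrite rmorphM hornerM gx mulr0.
  have hx : (map_poly iota h).[x] = 0.
    move: m_root; rewrite -gm rmorphM /root hornerM mulf_eq0 (negPf gx) orbF.
    by move/eqP.
  apply: contraTT (m_neq0) => sg; rewrite -gm (m_min _ hx) ?mul0r ?eqxx //.
  have h0 : h != 0 by apply: contraNneq m_neq0 => h0; rewrite -gm h0 mul0r.
  rewrite -gm size_mul // -subn1 -addnBA ?size_poly_gt0 //.
  rewrite -[X in (X < _)%N]addn0.
  rewrite ltn_add2l subn_gt0 ltn_neqAle eq_sym sg size_poly_gt0 //.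
have /Bezout_eq1_coprimepP[[u v] /= uv] := cop.
exists u; apply: (mulIf a0); rewrite mulVf //.
rewrite [X in _ * X]aE -hornerM -rmorphM.
have -> : u * p = 1 - v * m by rewrite -uv addrK.
rewrite rmorphB rmorphM rmorph1 hornerD hornerN hornerM hornerC.
by rewrite (rootP m_root) mulr0 subr0.
Qed.

Lemma adjoined_div a b : adjoined a -> adjoined b -> adjoined (a / b).
Proof. by move=> ? /adjoinedV; apply: adjoinedM. Qed.

(** The powers of [x] below the degree of [m] form a basis: division by [m]
    shows that they span, and minimality that they are independent. *)
Lemma adjoined_has_degree (K : L -> Prop) d :
    size m = d.+1 ->
    (forall a, K a <-> exists c, a = iota c) -> (forall a, adjoined a) ->
  has_degree K d.
Proof.
move=> sm KE gen.
exists (fun i => x ^+ i); split=> [a|c Kc c0].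
  have [p ->] := gen a; exists (fun i => iota (p %% m)`_i).
  split=> [i|]; first by apply/KE; exists (p %% m)`_i.
  rewrite {1}(divp_eq p m) rmorphD rmorphM hornerD hornerM (rootP m_root).
  rewrite mulr0 add0r (@horner_coef_wide _ d); last first.
    by rewrite size_map_poly -ltnS -sm ltn_modp.
  by apply: eq_bigr => i _; rewrite coef_map.
have [e eE] : exists e : 'I_d -> F, forall i, c i = iota (e i).
  have /fin_all_exists[e eE] : forall i, exists di, c i = iota di.
    by move=> i; apply/KE.
  by exists e.
pose p := \poly_(i < d) (if insub i is Some j then e j else 0).
have pE i : p`_(val i) = e i by rewrite coef_poly ltn_ord valK.
suff p0 : p = 0 by move=> i; rewrite eE -pE p0 coef0 rmorph0.
apply: m_min; first by rewrite sm ltnS size_poly.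
rewrite (@horner_coef_wide _ d) ?size_map_poly ?size_poly //.
by rewrite -[RHS]c0; apply: eq_bigr => i _; rewrite coef_map /= pE eE.
Qed.

End SimpleExtension.

(** * The Jacobian determinant *)

Lemma det3E (S : comNzRingType) (A : 'M[S]_3) :
  \det A = A 0 0 * (A 1 1 * A 2 2 - A 1 2 * A 2 1)
         - A 0 1 * (A 1 0 * A 2 2 - A 1 2 * A 2 0)
         + A 0 2 * (A 1 0 * A 2 1 - A 1 1 * A 2 0).
Proof.
rewrite (expand_det_row _ 0) !big_ord_recl big_ord0 /cofactor.
rewrite !(expand_det_row _ 0) !big_ord_recl !big_ord0 /cofactor.
rewrite !det_mx11 !mxE.
(* Entries indexed by naturals, so that iterated lifts become numerals. *)
pose a (i j : nat) := A (inord i) (inord j).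
have aE i j : A i j = a i j by rewrite /a !inord_val.
by rewrite !aE /= /bump /=; ring.
Qed.

Lemma mderivXU (S : nzRingType) n (i j : 'I_n) :
  ('X_i : {mpoly S[n]})^`M(j) = (i == j)%:R.
Proof.
rewrite mderivX mnm1E; case: eqP => [->|_]; last by rewrite scale0r.
suff -> : (U_(j) - U_(j))%MM = 0%MM :> 'X_{1..n} by rewrite mpolyX0 scale1r.
by apply/mnmP=> l; rewrite mnmBE mnm0E subnn.
Qed.

Lemma tnthF3 (k : fieldType) (i : 'I_3) : tnth (F3 k) i =
  [:: 'X_0 + 'X_0 ^+ 2 * 'X_1;
      'X_1 + 'X_0 * 'X_2 + 'X_0 ^+ 2 * 'X_1 * 'X_2;
      'X_2 + 'X_0 ^+ 2 * 'X_2 ^+ 2]`_i.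
Proof. exact: tnth_nth. Qed.

Lemma mpoly_two0 (k : fieldType) n :
  2%N \in [pchar k] -> 2%:R = 0 :> {mpoly k[n]}.
Proof. by move=> k2; rewrite -mpolyC_nat (pcharf0 k2) mpolyC0. Qed.

Lemma det_jacobianF3 (k : fieldType) :
  2%N \in [pchar k] -> \det (jacobian (F3 k)) = 1.
Proof.
move=> k2; rewrite det3E !mxE !tnthF3 /= ?expr2.
rewrite !(mderivD, mderivM, mderivXU) /=.
(* The derivative of a square, in the unreduced form the Leibniz rule leaves. *)
have dbl a : 1 * a + a * 1 = 0 :> {mpoly k[3]}.
  by rewrite mul1r mulr1 -mulr2n -mulr_natl mpoly_two0 ?mul0r.
by rewrite !dbl; ring.
Qed.

(** * Polynomial expressions in generators *)

Lemma poly_rmorph_ext (D S : nzRingType) (u v : {rmorphism {poly D} -> S}) :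
  (forall c, u c%:P = v c%:P) -> u 'X = v 'X -> u =1 v.
Proof.
move=> uvC uvX; elim/poly_ind=> [|p c IH]; first by rewrite !rmorph0.
by rewrite !rmorphD !rmorphM /= IH uvX uvC.
Qed.

Section SubfieldGen.
Variables (L : fieldType) (A : L -> Prop).
Let K := subfield_gen A.

Lemma subfield_gen0 : K 0.
Proof. by rewrite -(subrr 1); do 2?constructor. Qed.

Lemma subfield_genD a b : K a -> K b -> K (a + b).
Proof.
move=> Ka Kb; rewrite -[b]opprK -[- b]sub0r.
by apply: subfield_gen_sub => //; apply: subfield_gen_sub subfield_gen0 Kb.
Qed.

Lemma subfield_genM a b : K a -> K b -> K (a * b).
Proof.
move=> Ka Kb; rewrite -[b]invrK -[b^-1]mul1r.
by apply: subfield_gen_div => //; apply: subfield_gen_div (subfield_gen_1 _) Kb.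
Qed.

Lemma subfield_gen_poly (D : nzRingType) (u : {rmorphism {poly D} -> L}) :
  (forall c, K (u c%:P)) -> K (u 'X) -> forall p, K (u p).
Proof.
move=> KC KX; elim/poly_ind=> [|p c IH].
  by rewrite rmorph0; apply: subfield_gen0.
by rewrite rmorphD rmorphM; apply: subfield_genD => //; apply: subfield_genM.
Qed.

End SubfieldGen.

(** * The three sheets over R = 0, and the cubic *)

(** At R = 0 the cubic polynomial satisfied by the first coordinate t factors as
    (Q t + 1) (Q t^2 + t + P).  With P set to x + x^2 y and Q to y, the quadratic
    factor has the roots x and x + 1/y, and the linear factor has the root 1/y;
    the other two coordinates of each point are then determined by P and Q. *)
Definition fiber_point (E : fieldType) (x y : E) (j i : 'I_3) : E :=
  (nth [::] [:: [:: x; y; 0];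
                [:: x + y^-1; y; 0];
                [:: y^-1; y + y ^+ 2 * (x + x ^+ 2 * y); y ^+ 2]] j)`_i.

Lemma fiber_pointP (E : fieldType) (x y : E) j : 2%:R = 0 :> E -> y != 0 ->
  let h := fiber_point x y j in
  [/\ h 0 + h 0 ^+ 2 * h 1 = x + x ^+ 2 * y,
      h 1 + h 0 * h 2 + h 0 ^+ 2 * h 1 * h 2 = y
    & h 2 + h 0 ^+ 2 * h 2 ^+ 2 = 0].
Proof.
move=> two0 y0; rewrite /fiber_point; case: j => [[|[|[|//]]]] ? /=; split.
- by [].
- by ring.
- by ring.
- transitivity (x + x ^+ 2 * y + 2%:R * (x + y^-1)); first by field.
  by rewrite two0 mul0r addr0.
- by ring.
- by ring.
- transitivity (x + x ^+ 2 * y + 2%:R * y^-1); first by field.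
  by rewrite two0 mul0r addr0.
- transitivity (y + 2%:R * (y + y ^+ 2 * (x + x ^+ 2 * y))); first by field.
  by rewrite two0 mul0r addr0.
- transitivity (2%:R * y ^+ 2); first by field.
  by rewrite two0 mul0r.
Qed.

Lemma fiber_point_inj (E : fieldType) (x y : E) :
  x != 0 -> y != 0 -> x * y != 1 -> injective (fun j => fiber_point x y j 0).
Proof.
move=> x0 y0 xy1; have yi0 : y^-1 != 0 by rewrite invr_eq0.
have xy : x != y^-1 by apply: contraNneq xy1 => ->; rewrite mulVf.
have neq (i j : 'I_3) :
    (i < j)%N -> fiber_point x y i 0 != fiber_point x y j 0.
  rewrite /fiber_point; case: i j => [[|[|[|//]]]] ? [[|[|[|//]]]] ? //= _.
  - by rewrite -[X in X != _]addr0 (inj_eq (addrI x)) eq_sym.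
  - by rewrite -[X in _ != X]add0r (inj_eq (addIr _)).
move=> i j /eqP; case: (ltngtP i j) => [/neq/negPf->//|/neq|/val_inj//].
by rewrite eq_sym => /negPf->.
Qed.

(** For p, q fixed, this says that r is the rational function
    (q^2 x^3 + (p q + 1) x + p) / (p^2 x) of x. *)
Lemma cubic_relation (S : comNzRingType) (x y z : S) : 2%:R = 0 :> S ->
  let p := x + x ^+ 2 * y in
  let q := y + x * z + x ^+ 2 * y * z in
  let r := z + x ^+ 2 * z ^+ 2 in
  q ^+ 2 * x ^+ 3 + (p * q + 1 + r * p ^+ 2) * x + p = 0.
Proof.
(* Over the integers the left-hand side is twice the following polynomial. *)
move=> two0 /=; pose w := 1 + x * y.
transitivity (2%:R * (x ^+ 4 * y * z * w + x ^+ 5 * z ^+ 2 * w ^+ 2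
   + x ^+ 3 * z * w ^+ 2 + x ^+ 3 * y ^+ 2 + x ^+ 2 * y + x)).
  by rewrite /w; ring.
by rewrite two0 mul0r.
Qed.

(** * The degree of the extension *)

Section Degree.
Variable k : fieldType.
Hypothesis k2 : 2%N \in [pchar k].

Local Notation S := {mpoly k[3]}.
Local Notation T := {poly {poly {poly k}}}.
Local Notation E := {fraction {poly {poly k}}}.
Let P : S := 'X_0 + 'X_0 ^+ 2 * 'X_1.
Let Q : S := 'X_1 + 'X_0 * 'X_2 + 'X_0 ^+ 2 * 'X_1 * 'X_2.
Let R : S := 'X_2 + 'X_0 ^+ 2 * 'X_2 ^+ 2.

(** Evaluation at (P, Q, R).  The indeterminate standing for R is the outermost
    one, because the descent divides by it; the next stands for P and the
    innermost for Q. *)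
Definition eval_PQR : T -> S :=
  horner_eval R \o map_poly
    (horner_eval P \o map_poly (horner_eval Q \o map_poly (@mpolyC 3 k))).
HB.instance Definition _ := GRing.RMorphism.on eval_PQR.

Lemma eval_PQR_r : eval_PQR 'X = R.
Proof. by rewrite /eval_PQR /= map_polyX horner_evalE hornerX. Qed.

Lemma eval_PQR_p : eval_PQR 'X%:P = P.
Proof.
by rewrite /eval_PQR /= map_polyC /= map_polyX !horner_evalE hornerC hornerX.
Qed.

Lemma eval_PQR_q : eval_PQR 'X%:P%:P = Q.
Proof.
rewrite /eval_PQR /= !map_polyC /= !map_polyC /= !horner_evalE !hornerC.
by rewrite map_polyX hornerX.
Qed.

Lemma eval_PQR_c c : eval_PQR c%:P%:P%:P = c%:MP.
Proof.
rewrite /eval_PQR /= !map_polyC /= !map_polyC /= !map_polyC /=.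
by rewrite !horner_evalE !hornerC.
Qed.

Definition substitution (h : 'I_3 -> E) : S -> E :=
  mmap (@tofrac _ \o polyC \o polyC) h.
HB.instance Definition _ h := GRing.RMorphism.on (substitution h).

Lemma substitution_var h i : substitution h 'X_i = h i.
Proof. by rewrite /substitution mmapX mmap1U. Qed.

Lemma substitution_PQR h :
  [/\ substitution h P = h 0 + h 0 ^+ 2 * h 1,
      substitution h Q = h 1 + h 0 * h 2 + h 0 ^+ 2 * h 1 * h 2
    & substitution h R = h 2 + h 0 ^+ 2 * h 2 ^+ 2].
Proof.
by split; rewrite !(rmorphD, rmorphM, rmorphXn) /= ?substitution_var.
Qed.

Let X : E := tofrac 'X.
Let Y : E := tofrac 'X%:P.

Let Y0 : Y != 0. Proof. by rewrite tofrac_eq0 polyC_eq0 polyX_eq0. Qed.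

(** The value that the three sheets give to a polynomial in P and Q; it is
    injective because x + x^2 y and y are algebraically independent. *)
Let psi : {poly {poly k}} -> E := @tofrac _ \o comp_poly ('X + 'X ^+ 2 * 'X%:P).
HB.instance Definition _ := GRing.RMorphism.on psi.

Lemma substitution_eval_PQR h :
    substitution h P = X + X ^+ 2 * Y -> substitution h Q = Y ->
    substitution h R = 0 ->
  forall A, substitution h (eval_PQR A) = psi A.[0].
Proof.
move=> hP hQ hR.
apply: (@poly_rmorph_ext _ _ (substitution h \o eval_PQR)
    (psi \o horner_eval 0)) => /=; last first.
  by rewrite eval_PQR_r hR horner_evalE hornerX rmorph0.
move=> c; rewrite horner_evalE hornerC; move: c.
apply: (@poly_rmorph_ext _ _ (substitution h \o eval_PQR \o polyC)
    psi) => /=; last first.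
  by rewrite eval_PQR_p hP /psi /= comp_polyX rmorphD rmorphM rmorphXn.
apply: (@poly_rmorph_ext _ _ (substitution h \o eval_PQR \o polyC \o polyC)
    (psi \o polyC)) => /=; last first.
  by rewrite eval_PQR_q hQ /psi /= comp_polyC.
by move=> c; rewrite eval_PQR_c /psi /= comp_polyC [LHS]mmapC.
Qed.

Lemma psi_inj : injective psi.
Proof.
apply: raddf_inj => p; rewrite /psi /= => /eqP.
rewrite tofrac_eq0 comp_poly_eq0 => [/eqP//|].
rewrite ltnNge; apply/negP=> /leq_sizeP/(_ 2 isT)/eqP.
by rewrite coefD coefX coefMC coefXn mul1r add0r polyX_eq0.
Qed.

Let two0E : 2%:R = 0 :> E.
Proof.
by rewrite -(rmorph_nat (@tofrac _ \o polyC \o polyC)) (pcharf0 k2) rmorph0.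
Qed.

Let pt := fiber_point X Y.

Lemma pt_psi j A : substitution (pt j) (eval_PQR A) = psi A.[0].
Proof.
have [hP hQ hR] := substitution_PQR (pt j).
have [eP eQ eR] := fiber_pointP X j two0E Y0.
by apply: substitution_eval_PQR; rewrite ?hP ?hQ ?hR.
Qed.

Lemma pt_inj : injective (fun j => substitution (pt j) 'X_0).
Proof.
have X0 : X != 0 by rewrite tofrac_eq0 polyX_eq0.
have XY1 : X * Y != 1.
  (* The constant coefficients in the outer indeterminate are 0 and 1. *)
  rewrite -tofracM -[1]tofrac1 tofrac_eq.
  apply/eqP=> /(congr1 (fun p : {poly {poly k}} => p`_0)).
  by rewrite coefMC coefX mul0r coef1 => /esym/eqP; rewrite oner_eq0.
apply: (eq_inj (fiber_point_inj X0 Y0 XY1)) => j.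
by rewrite substitution_var.
Qed.

Lemma eval_PQR_X_neq0 : eval_PQR 'X != 0.
Proof.
rewrite eval_PQR_r; apply/eqP=> R0.
(* R takes the value 1 at (0, 0, 1). *)
have [_ _] := substitution_PQR (fun i => (i == 2)%:R); rewrite R0 rmorph0 /=.
by rewrite expr0n mul0r addr0 => /esym/eqP; rewrite oner_eq0.
Qed.

Lemma eval_PQR_independent (A : {poly T}) :
  (size A <= 3)%N -> (map_poly eval_PQR A).['X_0] = 0 -> A = 0.
Proof.
exact: (specialization_independent pt_psi psi_inj pt_inj eval_PQR_X_neq0).
Qed.

(** Independence of the powers of x, applied to a relation of degree 0. *)
Lemma eval_PQR_inj : injective (@tofrac _ \o eval_PQR).
Proof.
apply: raddf_inj => A /eqP; rewrite tofrac_eq0 => /eqP A0.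
suff: A%:P = 0 by move/eqP; rewrite polyC_eq0 => /eqP.
apply: eval_PQR_independent; first by rewrite (leq_trans (size_polyC_leq1 _)).
by rewrite map_polyC hornerC.
Qed.

(** The subfield k(P, Q, R) is the image of the fraction field of a polynomial
    ring, which makes the theory of simple extensions apply to it. *)
Lemma ratfun_genP (iota : {rmorphism {fraction T} -> ratfun k 3}) :
    (forall A, iota (tofrac A) = tofrac (eval_PQR A)) ->
  forall a, ratfun_gen (F3 k) a <-> exists c, a = iota c.
Proof.
move=> iotaE a; split.
  elim=> {a} [a [[c ->]|[i ->]]||a b _ [c ->] _ [d ->]|a b _ [c ->] _ [d ->]].
  - by exists (tofrac c%:P%:P%:P); rewrite iotaE eval_PQR_c.
  - rewrite tnthF3; case: i => [[|[|[|//]]]] ? /=.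
    + by exists (tofrac 'X%:P); rewrite iotaE eval_PQR_p.
    + by exists (tofrac 'X%:P%:P); rewrite iotaE eval_PQR_q.
    + by exists (tofrac 'X); rewrite iotaE eval_PQR_r.
  - by exists 1; rewrite rmorph1.
  - by exists (c - d); rewrite rmorphB.
  - by exists (c / d); rewrite fmorph_div.
case=> c ->; have [n [d [_ ->]]] := fraction_quotient c.
rewrite fmorph_div !iotaE.
have gF (i : 'I_3) (p : S) : tnth (F3 k) i = p -> ratfun_gen (F3 k) (tofrac p).
  by move=> <-; apply: subfield_gen_incl; right; exists i.
suff gT A : ratfun_gen (F3 k) (tofrac (eval_PQR A)).
  by apply: subfield_gen_div; apply: gT.
apply: (subfield_gen_poly (u := @tofrac _ \o eval_PQR))
    A => /= [A|]; last first.
  by rewrite eval_PQR_r; apply: (gF 2); rewrite tnthF3.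
apply: (subfield_gen_poly (u := @tofrac _ \o eval_PQR \o polyC))
    A => /= [A|]; last first.
  by rewrite eval_PQR_p; apply: (gF 0); rewrite tnthF3.
apply: (subfield_gen_poly (u := @tofrac _ \o eval_PQR \o polyC \o polyC))
    A => /= [A|]; last first.
  by rewrite eval_PQR_q; apply: (gF 1); rewrite tnthF3.
by rewrite eval_PQR_c; apply: subfield_gen_incl; left; exists A.
Qed.

Definition cubic : {poly T} :=
  Poly [:: 'X%:P;
           'X%:P * 'X%:P%:P + 1 + 'X * 'X%:P ^+ 2;
           0;
           'X%:P%:P ^+ 2].

Lemma size_cubic : size cubic = 4.
Proof.
by rewrite /cubic (PolyK (c := 0)) //= expf_neq0 // !polyC_eq0 polyX_eq0.
Qed.

Lemma root_cubic : (map_poly eval_PQR cubic).['X_0] = 0.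
Proof.
rewrite map_Poly_id0 ?rmorph0 // horner_Poly /=.
move: ('X : T) ('X%:P : T) ('X%:P%:P : T) eval_PQR_r eval_PQR_p eval_PQR_q.
move=> r p q rE pE qE.
have -> : eval_PQR (p * q + 1 + r * p ^+ 2) = P * Q + 1 + R * P ^+ 2.
  by rewrite rmorphD rmorphD rmorphM rmorph1 rmorphM rmorphXn /= rE pE qE.
rewrite rmorphXn rmorph0 /= pE qE.
rewrite -[RHS](cubic_relation 'X_0 'X_1 'X_2 (mpoly_two0 3 k2)) -/P -/Q -/R.
by ring.
Qed.

Lemma has_degree_F3 : has_degree (ratfun_gen (F3 k)) 3.
Proof.
have [iota iota_frac] := fraction_lift eval_PQR_inj.
have iotaE A : iota (tofrac A) = tofrac (eval_PQR A) := iota_frac A.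
have iotaP (A : {poly T}) :
    (map_poly iota (map_poly (@tofrac _) A)).[tofrac 'X_0] =
    tofrac (map_poly eval_PQR A).['X_0].
  rewrite -horner_map; congr _.[_]; apply/polyP=> i.
  by rewrite !coef_map /= iotaE.
pose m := map_poly (@tofrac _) cubic.
have sm : size m = 4.
  by rewrite (size_map_inj_poly (@tofrac_inj _)) ?size_cubic ?rmorph0.
have m0 : m != 0 by rewrite -size_poly_eq0 sm.
have mx : root (map_poly iota m) (tofrac 'X_0).
  by rewrite /root iotaP root_cubic rmorph0.
have m_min (p : {poly {fraction T}}) : (size p < size m)%N ->
    (map_poly iota p).[tofrac 'X_0] = 0 -> p = 0.
  rewrite sm ltnS => sp px; have [d d0 [q sq dpq]] := poly_common_denominator p.
  have q0 : q = 0.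
    apply: eval_PQR_independent; first by rewrite sq.
    apply/eqP; rewrite -tofrac_eq0 -iotaP -dpq map_polyZ hornerZ px mulr0.
    exact: eqxx.
  apply/eqP; move/eqP: dpq; rewrite q0 rmorph0 scale_poly_eq0 tofrac_eq0.
  by rewrite (negPf d0).
apply: (adjoined_has_degree m0 mx m_min sm (ratfun_genP iotaE)) => a.
have adjA A : adjoined iota (tofrac 'X_0) (tofrac (eval_PQR A)).
  by rewrite -iotaE; apply: adjoined_base.
have adjx := adjoined_gen iota (tofrac ('X_0 : S)).
have adjP := adjA 'X%:P; rewrite eval_PQR_p in adjP.
have adjQ := adjA 'X%:P%:P; rewrite eval_PQR_q in adjQ.
have div := adjoined_div m0 mx m_min.
have x0 : 'X_0 != 0 :> S.
  apply/eqP=> /(congr1 (meval (fun=> 1)))/eqP.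
  by rewrite mevalXU meval0 oner_eq0.
have P0 : P != 0.
  (* P takes the value 1 at (1, 0, 0). *)
  rewrite /P; apply/eqP=> /(congr1 (meval (fun i => (i == 0)%:R)))/eqP.
  by rewrite mevalD mevalM rmorphXn /= !mevalXU mulr0 addr0 meval0 oner_eq0.
have adjz : adjoined iota (tofrac 'X_0) (tofrac ('X_2 : S)).
  (* Multiply Q = y + z P by x^2 and replace x^2 y by P - x. *)
  have -> : tofrac ('X_2 : S) =
      tofrac ('X_0 + 'X_0 ^+ 2 * Q - P) / tofrac ('X_0 ^+ 2 * P).
    apply: (canRL (mulfK _)); first by rewrite tofrac_eq0 mulf_neq0 ?expf_neq0.
    by rewrite -tofracM /P /Q; congr tofrac; ring.
  rewrite tofracB tofracD !tofracM; apply: div; last by do 2?apply: adjoinedM.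
  apply: adjoinedD; last exact: adjoinedN.
  by apply: adjoinedD => //; do 2?apply: adjoinedM.
have adjy : adjoined iota (tofrac 'X_0) (tofrac ('X_1 : S)).
  have -> : 'X_1 = Q - 'X_2 * P by rewrite /P /Q; ring.
  by rewrite tofracB tofracM; apply: adjoinedD => //; apply/adjoinedN/adjoinedM.
have adjS (p : S) : adjoined iota (tofrac 'X_0) (tofrac p).
  apply: (adjoined_mpoly (u := @tofrac _)) p => /= [c|[[|[|[|//]]] i3]].
  - by rewrite -eval_PQR_c.
  - by rewrite (_ : Ordinal i3 = 0) //; apply: val_inj.
  - by rewrite (_ : Ordinal i3 = 1) //; apply: val_inj.
  - by rewrite (_ : Ordinal i3 = 2) //; apply: val_inj.
have [n [d [_ ->]]] := fraction_quotient a.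
exact: div.
Qed.

End Degree.

(** * Failure of injectivity and of the conjecture *)

Lemma F3_not_injective (k : fieldType) : 2%N \in [pchar k] ->
  exists u v : 3.-tuple k, u <> v /\ polymap (F3 k) u = polymap (F3 k) v.
Proof.
move=> k2; exists [tuple 0; 1; 0], [tuple 1; 1; 0]; split.
  move/(congr1 (fun t : 3.-tuple k => tnth t 0))/eqP.
  by rewrite /= eq_sym oner_eq0.
apply: eq_from_tnth => i; rewrite !tnth_mktuple tnthF3.
have two0 : 1 + 1 = 0 :> k by rewrite -(pcharf0 k2).
case: i => [[|[|[|//]]]] i3 /=;
  rewrite !(mevalD, mevalM, rmorphXn) /= !mevalXU !(tnth_nth 0) /=.
- by rewrite !(mul0r, mulr1) addr0 two0.
- by rewrite !mulr0.
- by rewrite !mulr0.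
Qed.

Lemma automorphism_injective (k : fieldType) n (F : n.-tuple {mpoly k[n]}) :
  polynomial_automorphism F -> injective (polymap F).
Proof.
case=> G [_ GF] u v uv; apply: eq_from_tnth => i.
have ev w : (tnth G i \mPo F).@[tnth w] = (tnth G i).@[tnth (polymap F w)].
  by rewrite comp_mpoly_meval; apply: meval_eq => j; rewrite tnth_mktuple.
by have := ev u; rewrite uv -ev GF !mevalXU.
Qed.

Theorem theorem1p2 :
  (forall k : fieldType, 2%N \in [pchar k] ->
     [/\ \det (jacobian (F3 k)) = 1,
         has_degree (ratfun_gen (F3 k)) 3
       & exists u v : 3.-tuple k, u <> v /\ polymap (F3 k) u = polymap (F3 k) v])
  /\ ~ separable_jacobian_conjecture 2 3.
Proof.
have counterexample (k : fieldType) : 2%N \in [pchar k] ->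
    [/\ \det (jacobian (F3 k)) = 1,
        has_degree (ratfun_gen (F3 k)) 3
      & exists u v : 3.-tuple k, u <> v /\ polymap (F3 k) u = polymap (F3 k) v].
  move=> k2; split; first exact: det_jacobianF3.
    exact: has_degree_F3.
  exact: F3_not_injective.
split=> // sjc.
have F2char : 2%N \in [pchar 'F_2] by exact: pchar_Fp.
have [detF degF [u [v [uv Fuv]]]] := counterexample 'F_2 F2char.
apply/uv/(automorphism_injective (sjc 'F_2 F2char (F3 _) _ _)) => //.
  by exists 1; rewrite ?oner_neq0 // detF mpolyC1.
by exists 3.
Qed.
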